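(* Let $a,b_1,b_2,c,t_1,t_2\in\mathbb{C}$ with $\Re(c)\ne0,-1,-2,\dots$, let $k_1,k_2\in\mathbb{N}$, and let $|x|<1$, $|y|<1$. Write $\mathcal{F}=\mathcal{F}_1^{(1)}(a,b_1,b_2;c;t_1,t_2,k_1,k_2,x,y)$, regarded as a function of $(t_1,t_2)$. Then $\mathcal{F}$ satisfies the difference equations (1) $$\Theta_{t_1}\left(\tfrac1{k_1}\Theta_{t_1}+\tfrac1{k_2}\Theta_{t_2}+c-1\right)\mathcal{F}=k_1(-1)^{k_1}(-t_1)_{k_1}\,x\,\rho_{t_1}^{k_1}\left(\tfrac1{k_1}\Theta_{t_1}+\tfrac1{k_2}\Theta_{t_2}+a\right)\left(\tfrac1{k_1}\Theta_{t_1}+b_1\right)\mathcal{F};$$ (2) $$\Theta_{t_2}\left(\tfrac1{k_1}\Theta_{t_1}+\tfrac1{k_2}\Theta_{t_2}+c-1\right)\mathcal{F}=k_2(-1)^{k_2}(-t_2)_{k_2}\,y\,\rho_{t_2}^{k_2}\left(\tfrac1{k_1}\Theta_{t_1}+\tfrac1{k_2}\Theta_{t_2}+a\right)\left(\tfrac1{k_2}\Theta_{t_2}+b_2\right)\mathcal{F};$$ (3) $$\left[k_2(-1)^{k_2}(-t_2)_{k_2}\,y\,\rho_{t_2}^{k_2}\,\Theta_{t_1}\left(\tfrac1{k_2}\Theta_{t_2}+b_2\right)-k_1(-1)^{k_1}(-t_1)_{k_1}\,x\,\rho_{t_1}^{k_1}\,\Theta_{t_2}\left(\tfrac1{k_1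}\Theta_{t_1}+b_1\right)\right]\mathcal{F}=0.$$
   Context: $\mathbb{N}$ is the set of natural numbers. The Pochhammer symbol is $(u)_0=1$, $(u)_k=u(u+1)\cdots(u+k-1)$ for $k\ge1$. The first discrete Appell function is $$\mathcal{F}_1^{(1)}(a,b_1,b_2;c;t_1,t_2,k_1,k_2,x,y)=\sum_{m,n\ge 0}\frac{(a)_{m+n}(b_1)_m(b_2)_n(-1)^{mk_1}(-1)^{nk_2}(-t_1)_{mk_1}(-t_2)_{nk_2}}{(c)_{m+n}\,m!\,n!}x^my^n .$$ For a function $f$ of $t$: $\Delta_tf(t)=f(t+1)-f(t)$, $\rho_tf(t)=f(t-1)$, and $\Theta_t=t\,\rho_t\,\Delta_t$, i.e. $\Theta_tf(t)=t\,(f(t)-f(t-1))$. Products of operators are compositions, applied from right to left, and functions of $t_1,t_2$ written on the left (such as $(-t_1)_{k_1}$) act by multiplication. *)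

(* Defs.v *)
From mathcomp Require Import all_boot all_order all_algebra.
From mathcomp Require Import all_classical all_reals all_analysis.
From mathcomp Require Import complex.
From mathcomp.analysis.showcase Require Import summability.
Import Order.TTheory GRing.Theory Num.Theory.
Import numFieldNormedType.Exports.
Set Implicit Arguments.
Unset Strict Implicit.
Unset Printing Implicit Defensive.
Local Open Scope ring_scope.
Local Open Scope complex_scope.

Definition pochhammer (K : pzRingType) (u : K) (k : nat) : K :=
  \prod_(i < k) (u + i%:R).

Section Operators.
Variables (K : fieldType) (V : lmodType K).

Definition Delta (f : K -> V) : K -> V := fun t => f (t + 1) - f t.
Definition rho (f : K -> V) : K -> V := fun t => f (t - 1).
Definition Theta (f : K -> V) : K -> V := fun t => t *: rho (Delta f) t.

(* Functions of (t1, t2) and operators on them; sums and scalar multiples of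
   operators are the pointwise ones, products are compositions. *)
Definition fun2 := K -> K -> V.
Definition oper := fun2 -> fun2.

Definition in_t1 (T : (K -> V) -> (K -> V)) : oper :=
  fun F t1 t2 => T (fun s => F s t2) t1.
Definition in_t2 (T : (K -> V) -> (K -> V)) : oper :=
  fun F t1 t2 => T (fun s => F t1 s) t2.

Definition mul_by (g : K -> K -> K) : oper :=
  fun F t1 t2 => g t1 t2 *: F t1 t2.
Definition pointwise (X : V -> V) : oper := fun F t1 t2 => X (F t1 t2).

Notation Theta1 := (in_t1 Theta).
Notation Theta2 := (in_t2 Theta).
Notation rho1 := (in_t1 rho).
Notation rho2 := (in_t2 rho).

(* X and Y are "multiplication by x" and "multiplication by y" on the space V
   of values. *)
Definition appell1_system (a b1 b2 c : K) (k1 k2 : nat) (X Y : V -> V)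
    (F : fun2) (t1 t2 : K) : Prop :=
  let E (u : K) : oper :=
    (k1%:R^-1 *: (Theta1 : oper) + k2%:R^-1 *: (Theta2 : oper)
     + u *: (idfun : oper)) in
  let B1 : oper := k1%:R^-1 *: (Theta1 : oper) + b1 *: (idfun : oper) in
  let B2 : oper := k2%:R^-1 *: (Theta2 : oper) + b2 *: (idfun : oper) in
  let S1 : oper :=
    mul_by (fun s1 _ => k1%:R * (-1) ^+ k1 * pochhammer (- s1) k1)
      \o pointwise X \o iter k1 rho1 in
  let S2 : oper :=
    mul_by (fun _ s2 => k2%:R * (-1) ^+ k2 * pochhammer (- s2) k2)
      \o pointwise Y \o iter k2 rho2 in
  [/\ (Theta1 \o E (c - 1)) F t1 t2 = (S1 \o E a \o B1) F t1 t2,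
      (Theta2 \o E (c - 1)) F t1 t2 = (S2 \o E a \o B2) F t1 t2 &
      ((S2 \o Theta1 \o B2 : oper) - (S1 \o Theta2 \o B1 : oper)) F t1 t2 = 0].

End Operators.

Section DiscreteAppell.
Variable R : realType.
Local Notation C := R[i].

Definition appell1_coef (a b1 b2 c t1 t2 : C) (k1 k2 m n : nat) : C :=
  (pochhammer a (m + n) * pochhammer b1 m * pochhammer b2 n
   * (-1) ^+ (m * k1) * (-1) ^+ (n * k2)
   * pochhammer (- t1) (m * k1) * pochhammer (- t2) (n * k2))
  / (pochhammer c (m + n) * m`!%:R * n`!%:R).

(* R[i] carries its topology and norm through the alias R[i]^o.  [sum] is the
   unconditional sum, the limit over the finite sets of indices (m, n); where
   the series diverges it takes the default value [point], which is 0. *)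
Definition appell1 (a b1 b2 c t1 t2 : C) (k1 k2 : nat) (x y : C) : C^o :=
  sum (fun p : nat * nat =>
    appell1_coef a b1 b2 c t1 t2 k1 k2 p.1 p.2 * x ^+ p.1 * y ^+ p.2 : C^o).

(* A formal power series in x, y is the family of its coefficients; the series
   below is the same double series with x, y indeterminates.  It makes sense
   for all t1, t2, whereas for t1 not a natural number (-t1)_(m k1) / m! makes
   the numerical series diverge unless x = 0 or a or b1 is in {0, -1, ...}. *)
Definition series2 := nat -> nat -> C^o.

Definition appell1_series (a b1 b2 c t1 t2 : C) (k1 k2 : nat) : series2 :=
  fun m n => appell1_coef a b1 b2 c t1 t2 k1 k2 m n.

Definition series2_mulx (s : series2) : series2 :=
  fun m n => if m is m'.+1 then s m' n else 0.
Definition series2_muly (s : series2) : series2 :=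
  fun m n => if n is n'.+1 then s m n' else 0.

End DiscreteAppell.

(* Main.v *)
From HB Require Import structures.
Require Import Defs.
From mathcomp Require Import all_boot all_order all_algebra.
From mathcomp Require Import all_classical all_reals all_analysis.
From mathcomp Require Import complex.
From mathcomp Require Import ring zify.
From mathcomp Require finmap.
From mathcomp.analysis.showcase Require Import summability.
Import Order.TTheory GRing.Theory Num.Theory.
Import numFieldNormedType.Exports.
Local Open Scope ring_scope.
Local Open Scope complex_scope.

(* The coefficient of x^m y^n factors as r (m + n) * p t1 m * q t2 n, where
   r l = (a)_l / (c)_l.  Each p is an eigenfunction of Theta with eigenvalue
   m k1, and (-1)^k1 (-t1)_k1 (b1 + m) p (t1 - k1) m = (m + 1) p t1 (m + 1); with
   (a + l) r l = (c + l) r (l + 1) the equations hold coefficientwise.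

   For the numerical sum there is a dichotomy.  Either the series has only
   finitely many nonzero terms, and its value is a linear functional of the
   coefficients; or its terms along one axis are bounded away from 0 (their
   ratio grows without bound), so that it diverges and takes the value 0.  The
   operators evaluate their argument at (t1 - i, t2 - j) only with a factor that
   vanishes when t1 is one of 0, ..., i - 1, or t2 one of 0, ..., j - 1, and along the
   remaining shifts the same side of the dichotomy persists. *)

(** * Pochhammer symbols and the one-variable factors of the coefficients *)

Section Pochhammer.
Context {K : numFieldType}.
Implicit Types (u a b c t : K) (k l m : nat).

Lemma pochhammerS u k : pochhammer u k.+1 = pochhammer u k * (u + k%:R).
Proof. by rewrite /pochhammer big_ord_recr. Qed.

Lemma pochhammer0 u : pochhammer u 0 = 1.
Proof. by rewrite /pochhammer big_ord0. Qed.

Lemma pochhammerD u k l :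
  pochhammer u (k + l) = pochhammer u k * pochhammer (u + k%:R) l.
Proof.
elim: l => [|l IHl]; first by rewrite addn0 pochhammer0 mulr1.
by rewrite addnS !pochhammerS IHl natrD addrA mulrA.
Qed.

(** Both sides are [pochhammer u k.+1], with its first or its last factor split off. *)
Lemma pochhammer_shift u k :
  u * pochhammer (u + 1) k = pochhammer u k * (u + k%:R).
Proof.
by rewrite -pochhammerS -add1n pochhammerD pochhammerS pochhammer0 mul1r addr0.
Qed.

Lemma pochhammer_neq0 u k :
  (forall i, (i < k)%N -> u + i%:R != 0) -> pochhammer u k != 0.
Proof. by move=> hu; apply/prodf_neq0 => i _; apply: hu. Qed.

Definition poch_ratio a c l : K := pochhammer a l / pochhammer c l.

Lemma poch_ratioS a c l : c + l%:R != 0 ->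
  (a + l%:R) * poch_ratio a c l = (c + l%:R) * poch_ratio a c l.+1.
Proof.
move=> hc; rewrite /poch_ratio !pochhammerS invfM.
by rewrite [RHS]mulrC -!mulrA mulVf //; ring.
Qed.

(** A zero factor of either symbol persists as the index grows; a vanishing denominator counts as
    well, its inverse being 0. *)
Lemma poch_ratio_eq0 a c l l' :
  (l <= l')%N -> poch_ratio a c l = 0 -> poch_ratio a c l' = 0.
Proof.
move=> /subnKC <- /eqP; rewrite /poch_ratio !pochhammerD invfM.
by rewrite mulf_eq0 => /orP[]/eqP->; rewrite !(mul0r, mulr0).
Qed.

Definition appell_factor b k t m : K :=
  pochhammer b m * (-1) ^+ (m * k) * pochhammer (- t) (m * k) / m`!%:R.

(** This is [pochhammer_shift] at [- t], kept free of division so that it holds at [t = 0] too. *)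
Lemma appell_factor_shift b k t m :
  t * appell_factor b k (t - 1) m = (t - (m * k)%:R) * appell_factor b k t m.
Proof.
rewrite /appell_factor opprB (addrC 1).
have := pochhammer_shift (- t) (m * k).
set P := pochhammer (- t + 1) _; set Q := pochhammer (- t) _ => PQ.
have -> : (t - (m * k)%:R) * (pochhammer b m * (-1) ^+ (m * k) * Q / m`!%:R)
  = - (Q * (- t + (m * k)%:R)) * pochhammer b m * (-1) ^+ (m * k) / m`!%:R by ring.
by rewrite -PQ; ring.
Qed.

Lemma appell_factor_eigen b k t m :
  t * (appell_factor b k t m - appell_factor b k (t - 1) m)
  = (m * k)%:R * appell_factor b k t m.
Proof. by rewrite mulrBr appell_factor_shift; ring. Qed.

(** The symbols [(-t)_k] and [(k-t)_{mk}] join to [(-t)_{(m+1)k}], [b + m] completes [(b)_{m+1}],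
    and [m + 1] accounts for the factorial. *)
Lemma appell_factorS b k t m :
  (-1) ^+ k * pochhammer (- t) k * (b + m%:R) * appell_factor b k (t - k%:R) m
  = m.+1%:R * appell_factor b k t m.+1.
Proof.
rewrite /appell_factor mulSn pochhammerS exprD pochhammerD opprB (addrC k%:R).
rewrite factS natrM; field.
by rewrite nat1r !pnatr_eq0 -lt0n fact_gt0.
Qed.

Lemma appell_factor_shift_eq0 b k t m : t != 0 ->
  appell_factor b k t m = 0 -> appell_factor b k (t - 1) m = 0.
Proof.
move=> t0 h; apply/eqP; rewrite -(mulrI_eq0 _ (mulfI t0)).
by rewrite appell_factor_shift h mulr0.
Qed.
End Pochhammer.

(** * Iterated unit shifts *)

Lemma iter_rho1 (K : fieldType) (V : lmodType K) k (F : fun2 V) s1 s2 :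
  iter k (in_t1 (@rho K V)) F s1 s2 = F (s1 - k%:R) s2.
Proof.
elim: k s1 => [|k IHk] s1 /=; first by rewrite subr0.
by rewrite {1}/in_t1 /rho IHk -addrA -opprD nat1r.
Qed.

Lemma iter_rho2 (K : fieldType) (V : lmodType K) k (F : fun2 V) s1 s2 :
  iter k (in_t2 (@rho K V)) F s1 s2 = F s1 (s2 - k%:R).
Proof.
elim: k s2 => [|k IHk] s2 /=; first by rewrite subr0.
by rewrite {1}/in_t2 /rho IHk -addrA -opprD nat1r.
Qed.

(** A nonzero [(-t)_k] means that [t], ..., [t - k + 1] are all nonzero, so each of the [k] unit
    steps down from [t] stays in [D]. *)
Lemma pochhammer_closed {K : numFieldType} (D : K -> Prop) (t : K) k :
  (forall s, D s -> s != 0 -> D (s - 1)) -> D t ->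
  pochhammer (- t) k != 0 -> D (t - k%:R).
Proof.
move=> DB Dt; elim: k => [|k IHk]; first by rewrite subr0.
rewrite pochhammerS mulf_eq0 negb_or => /andP[/IHk Dk nz].
rewrite -natr1 opprD addrA; apply: DB => //.
by rewrite -oppr_eq0 opprB addrC.
Qed.

(** * Difference operators as weights on the coefficients *)

Section Formal.
Context {R : realType}.
Local Notation C := R[i].
Variables (a b1 b2 c : C) (k1 k2 : nat).
Hypothesis hc : forall n, c + n%:R != 0.
Hypothesis k1_gt0 : (0 < k1)%N.
Hypothesis k2_gt0 : (0 < k2)%N.

Let r := poch_ratio a c.
Let p := appell_factor b1 k1.
Let q := appell_factor b2 k2.

Definition appell_ser (s1 s2 : C) : series2 R :=
  fun m n => r (m + n) * p s1 m * q s2 n.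

(* The shifts by x and y yield coefficientwise multiples of this series, which
   in equation (3), lacking a factor [a + m + n] to advance [r], need not be
   multiples of [appell_ser]. *)
Definition appell_ser_pred (s1 s2 : C) : series2 R :=
  fun m n => r (m + n).-1 * p s1 m * q s2 n.

Definition mul_coef (w : nat -> nat -> C) (s : series2 R) : series2 R :=
  fun m n => w m n * s m n.

(* [Phi] will be the identity for formal series, a truncated evaluation at
   (x, y) where the numerical series is finite, and 0 where it diverges; [D] is
   a set of points (t1, t2) on which the same [Phi] computes the function. *)
Variables (V : lmodType C) (Phi : {linear series2 R -> V}) (X Y : V -> V).
Hypothesis XZ : forall g v, g *: X v = X (g *: v).
Hypothesis YZ : forall g v, g *: Y v = Y (g *: v).
Variable D : C -> C -> Prop.
Hypothesis D1 : forall s1 s2, D s1 s2 -> s1 != 0 -> D (s1 - 1) s2.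
Hypothesis D2 : forall s1 s2, D s1 s2 -> s2 != 0 -> D s1 (s2 - 1).
Hypothesis PhiX : forall s1 s2 s w, D s1 s2 ->
  series2_mulx s = mul_coef w (appell_ser_pred s1 s2) ->
  X (Phi s) = Phi (series2_mulx s).
Hypothesis PhiY : forall s1 s2 s w, D s1 s2 ->
  series2_muly s = mul_coef w (appell_ser_pred s1 s2) ->
  Y (Phi s) = Phi (series2_muly s).

(** Reduces operator identities to arithmetic of weights: the Theta operators, [E], [B1] and [B2]
    each multiply [w] by an eigenvalue. *)
Definition acts_by (w : nat -> nat -> C) (H : fun2 V) :=
  forall s1 s2, D s1 s2 -> H s1 s2 = Phi (mul_coef w (appell_ser s1 s2)).

Lemma acts_by_Theta1 w H : acts_by w H ->
  acts_by (fun m n => (m * k1)%:R * w m n) (in_t1 (@Theta _ _) H).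
Proof.
move=> hH s1 s2 Ds; rewrite /in_t1 /Theta /rho /Delta subrK (hH _ _ Ds).
transitivity (s1 *: Phi (mul_coef w (appell_ser s1 s2)
    - mul_coef w (appell_ser (s1 - 1) s2))).
  (* At [s1 = 0] the point [s1 - 1] may lie outside [D], but the value there is multiplied by 0. *)
  have [->|nz] := eqVneq s1 0; first by rewrite !scale0r.
  by rewrite (hH _ _ (D1 _ _ Ds nz)) -(linearB Phi).
rewrite -linearZ; congr (Phi _); apply/funext => m; apply/funext => n.
have e : s1 * (p s1 m - p (s1 - 1) m) = (m * k1)%:R * p s1 m.
  exact: appell_factor_eigen.
rewrite -[LHS]/(s1 * (w m n * (r (m + n) * p s1 m * q s2 n)
   - w m n * (r (m + n) * p (s1 - 1) m * q s2 n))).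
rewrite /mul_coef /appell_ser.
transitivity (w m n * r (m + n) * q s2 n * (s1 * (p s1 m - p (s1 - 1) m))).
  by ring.
by rewrite e; ring.
Qed.

Lemma acts_by_Theta2 w H : acts_by w H ->
  acts_by (fun m n => (n * k2)%:R * w m n) (in_t2 (@Theta _ _) H).
Proof.
move=> hH s1 s2 Ds; rewrite /in_t2 /Theta /rho /Delta subrK (hH _ _ Ds).
transitivity (s2 *: Phi (mul_coef w (appell_ser s1 s2)
    - mul_coef w (appell_ser s1 (s2 - 1)))).
  have [->|nz] := eqVneq s2 0; first by rewrite !scale0r.
  by rewrite (hH _ _ (D2 _ _ Ds nz)) -(linearB Phi).
rewrite -linearZ; congr (Phi _); apply/funext => m; apply/funext => n.
have e : s2 * (q s2 n - q (s2 - 1) n) = (n * k2)%:R * q s2 n.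
  exact: appell_factor_eigen.
rewrite -[LHS]/(s2 * (w m n * (r (m + n) * p s1 m * q s2 n)
   - w m n * (r (m + n) * p s1 m * q (s2 - 1) n))).
rewrite /mul_coef /appell_ser.
transitivity (w m n * r (m + n) * p s1 m * (s2 * (q s2 n - q (s2 - 1) n))).
  by ring.
by rewrite e; ring.
Qed.

Lemma acts_byZ g w H : acts_by w H ->
  acts_by (fun m n => g * w m n) (fun s1 s2 => g *: H s1 s2).
Proof.
move=> hH s1 s2 Ds; rewrite (hH _ _ Ds) -linearZ; congr (Phi _).
by apply/funext => m; apply/funext => n; rewrite /mul_coef -mulrA.
Qed.

Lemma acts_byD w w' H H' : acts_by w H -> acts_by w' H' ->
  acts_by (fun m n => w m n + w' m n) (fun s1 s2 => H s1 s2 + H' s1 s2).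
Proof.
move=> hH hH' s1 s2 Ds; rewrite (hH _ _ Ds) (hH' _ _ Ds) -linearD; congr (Phi _).
by apply/funext => m; apply/funext => n; rewrite /mul_coef mulrDl.
Qed.

Lemma acts_by_eq w w' H : (forall m n, w m n = w' m n) ->
  acts_by w H -> acts_by w' H.
Proof. by move=> /(_ _)/funext e; have -> : w' = w by apply/funext => m; rewrite e. Qed.

Let E u : oper V := k1%:R^-1 *: (in_t1 (@Theta _ _) : oper V)
  + k2%:R^-1 *: (in_t2 (@Theta _ _) : oper V) + u *: (idfun : oper V).
Let B1 : oper V :=
  k1%:R^-1 *: (in_t1 (@Theta _ _) : oper V) + b1 *: (idfun : oper V).
Let B2 : oper V :=
  k2%:R^-1 *: (in_t2 (@Theta _ _) : oper V) + b2 *: (idfun : oper V).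

Let k1_neq0 : k1%:R != 0 :> C. Proof. by rewrite pnatr_eq0 -lt0n. Qed.
Let k2_neq0 : k2%:R != 0 :> C. Proof. by rewrite pnatr_eq0 -lt0n. Qed.

Lemma acts_by_E u w H : acts_by w H ->
  acts_by (fun m n => (m%:R + n%:R + u) * w m n) (E u H).
Proof.
move=> hH.
have := acts_byD _ _ _ _ (acts_byD _ _ _ _
  (acts_byZ k1%:R^-1 _ _ (acts_by_Theta1 _ _ hH))
  (acts_byZ k2%:R^-1 _ _ (acts_by_Theta2 _ _ hH))) (acts_byZ u _ _ hH).
apply: acts_by_eq => m n; rewrite !natrM; field.
by rewrite k1_neq0 k2_neq0.
Qed.

Lemma acts_by_B1 w H : acts_by w H ->
  acts_by (fun m n => (b1 + m%:R) * w m n) (B1 H).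
Proof.
move=> hH.
have := acts_byD _ _ _ _
  (acts_byZ k1%:R^-1 _ _ (acts_by_Theta1 _ _ hH)) (acts_byZ b1 _ _ hH).
by apply: acts_by_eq => m n; rewrite !natrM; field.
Qed.

Lemma acts_by_B2 w H : acts_by w H ->
  acts_by (fun m n => (b2 + n%:R) * w m n) (B2 H).
Proof.
move=> hH.
have := acts_byD _ _ _ _
  (acts_byZ k2%:R^-1 _ _ (acts_by_Theta2 _ _ hH)) (acts_byZ b2 _ _ hH).
by apply: acts_by_eq => m n; rewrite !natrM; field.
Qed.

(** The factor [b1 + m] of the weight is what [appell_factorS] needs to raise the index of [p].
    After multiplication by x, [p] sits at the new index while [r] and [w] keep the old one; at
    [m = 0] the factor [m * k1] makes the truncated predecessor harmless. *)
Lemma acts_by_S1 w H t1 t2 : D t1 t2 ->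
  acts_by (fun m n => (b1 + m%:R) * w m n) H ->
  (mul_by (fun s1 _ => k1%:R * (-1) ^+ k1 * pochhammer (- s1) k1)
    \o pointwise X \o iter k1 (in_t1 (@rho _ _))) H t1 t2
  = Phi (mul_coef (fun m n => (m * k1)%:R * w m.-1 n) (appell_ser_pred t1 t2)).
Proof.
move=> Dt hH; rewrite /= /mul_by /pointwise iter_rho1 XZ.
set g := _ * pochhammer _ _.
pose s := g *: mul_coef (fun m n => (b1 + m%:R) * w m n) (appell_ser (t1 - k1%:R) t2).
(* If [g = 0], nothing need be known about [H] at the shifted point; otherwise [pochhammer_closed]
   puts that point in [D]. *)
have -> : g *: H (t1 - k1%:R) t2 = Phi s.
  rewrite /s (linearZ_LR Phi); have [->|gnz] := eqVneq g 0; first by rewrite !scale0r.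
  rewrite hH //; apply: (@pochhammer_closed _ (fun s => D s t2) t1 k1) => //.
    by move=> s1; apply: D1.
  by move: gnz; rewrite mulf_eq0 negb_or => /andP[].
have es : series2_mulx s
    = mul_coef (fun m n => (m * k1)%:R * w m.-1 n) (appell_ser_pred t1 t2).
  apply/funext => -[|m]; apply/funext => n.
    by rewrite /mul_coef mul0n !mul0r.
  rewrite /mul_coef /appell_ser_pred /= /s.
  rewrite -[LHS]/(g * ((b1 + m%:R) * w m n
    * (r (m + n) * p (t1 - k1%:R) m * q t2 n))).
  have e : (-1) ^+ k1 * pochhammer (- t1) k1 * (b1 + m%:R) * p (t1 - k1%:R) m
      = m.+1%:R * p t1 m.+1 by exact: appell_factorS.
  transitivity (k1%:R * w m n * r (m + n) * q t2 n * (m.+1%:R * p t1 m.+1)).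
    by rewrite -e /g; ring.
  by rewrite natrM; ring.
by rewrite (PhiX _ _ _ _ Dt es) es.
Qed.

Lemma acts_by_S2 w H t1 t2 : D t1 t2 ->
  acts_by (fun m n => (b2 + n%:R) * w m n) H ->
  (mul_by (fun _ s2 => k2%:R * (-1) ^+ k2 * pochhammer (- s2) k2)
    \o pointwise Y \o iter k2 (in_t2 (@rho _ _))) H t1 t2
  = Phi (mul_coef (fun m n => (n * k2)%:R * w m n.-1) (appell_ser_pred t1 t2)).
Proof.
move=> Dt hH; rewrite /= /mul_by /pointwise iter_rho2 YZ.
set g := _ * pochhammer _ _.
pose s := g *: mul_coef (fun m n => (b2 + n%:R) * w m n) (appell_ser t1 (t2 - k2%:R)).
have -> : g *: H t1 (t2 - k2%:R) = Phi s.
  rewrite /s (linearZ_LR Phi); have [->|gnz] := eqVneq g 0; first by rewrite !scale0r.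
  rewrite hH //; apply: (@pochhammer_closed _ (D t1) t2 k2) => //.
    by move=> s2; apply: D2.
  by move: gnz; rewrite mulf_eq0 negb_or => /andP[].
have es : series2_muly s
    = mul_coef (fun m n => (n * k2)%:R * w m n.-1) (appell_ser_pred t1 t2).
  apply/funext => m; apply/funext => -[|n].
    by rewrite /mul_coef mul0n !mul0r.
  rewrite /mul_coef /appell_ser_pred /= /s.
  rewrite -[LHS]/(g * ((b2 + n%:R) * w m n
    * (r (m + n) * p t1 m * q (t2 - k2%:R) n))).
  have e : (-1) ^+ k2 * pochhammer (- t2) k2 * (b2 + n%:R) * q (t2 - k2%:R) n
      = n.+1%:R * q t2 n.+1 by exact: appell_factorS.
  transitivity (k2%:R * w m n * r (m + n) * p t1 m * (n.+1%:R * q t2 n.+1)).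
    by rewrite -e /g; ring.
  by rewrite addnS natrM /=; ring.
by rewrite (PhiY _ _ _ _ Dt es) es.
Qed.

(** This is [poch_ratioS] at [l = m + n - 1]. Advancing [r] by one matches the right sides of the
    first two equations with their left sides. *)
Lemma appell_ser_predE m n s1 s2 : (0 < m + n)%N ->
  (a + (m + n).-1%:R) * appell_ser_pred s1 s2 m n
  = (m%:R + n%:R + (c - 1)) * appell_ser s1 s2 m n.
Proof.
rewrite /appell_ser_pred /appell_ser; case mn: (m + n)%N => [//|l] _ /=.
have -> : m%:R + n%:R + (c - 1) = c + l%:R :> C.
  by rewrite -natrD mn -natr1; ring.
have e : (a + l%:R) * r l = (c + l%:R) * r l.+1 := poch_ratioS a c l (hc l).
by move: (r l) (r l.+1) (p s1 m) (q s2 n) e => ? ? ? ? e; rewrite !mulrA e.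
Qed.

(** Each side of the equations is [Phi] of a weighted series, so only coefficients have to be
    compared. *)
Theorem appell1_system_of_linear (F : fun2 V) t1 t2 :
  (forall s1 s2, D s1 s2 -> F s1 s2 = Phi (appell_ser s1 s2)) ->
  D t1 t2 -> appell1_system a b1 b2 c k1 k2 X Y F t1 t2.
Proof.
move=> FE Dt.
have hF : acts_by (fun _ _ => 1) F.
  move=> s1 s2 /FE ->; congr (Phi _).
  by apply/funext => m; apply/funext => n; rewrite /mul_coef mul1r.
split.
- rewrite -[LHS]/(in_t1 (@Theta _ _) (E (c - 1) F) t1 t2).
  rewrite (acts_by_Theta1 _ _ (acts_by_E (c - 1) _ _ hF) _ _ Dt).
  rewrite -[RHS]/((mul_by (fun s1 _ => k1%:R * (-1) ^+ k1 * pochhammer (- s1) k1)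
    \o pointwise X \o iter k1 (in_t1 (@rho _ _))) (E a (B1 F)) t1 t2).
  rewrite (acts_by_S1 (fun m n => m%:R + n%:R + a) _ _ _ Dt); last first.
    have := acts_by_E a _ _ (acts_by_B1 _ _ hF).
    by apply: acts_by_eq => m n; ring.
  congr (Phi _); apply/funext => m; apply/funext => n; rewrite /mul_coef.
  (* At [m = 0] both weights contain the factor [m * k1]; otherwise [m + n] is positive, as
     [appell_ser_predE] requires. *)
  case: m => [|m]; first by rewrite mul0n !mul0r.
  rewrite -[LHS]mulrA -[RHS]mulrA; congr (_ * _).
  rewrite mulr1 -appell_ser_predE //= natrD; congr (_ * _); ring.
- rewrite -[LHS]/(in_t2 (@Theta _ _) (E (c - 1) F) t1 t2).
  rewrite (acts_by_Theta2 _ _ (acts_by_E (c - 1) _ _ hF) _ _ Dt).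
  rewrite -[RHS]/((mul_by (fun _ s2 => k2%:R * (-1) ^+ k2 * pochhammer (- s2) k2)
    \o pointwise Y \o iter k2 (in_t2 (@rho _ _))) (E a (B2 F)) t1 t2).
  rewrite (acts_by_S2 (fun m n => m%:R + n%:R + a) _ _ _ Dt); last first.
    have := acts_by_E a _ _ (acts_by_B2 _ _ hF).
    by apply: acts_by_eq => m n; ring.
  congr (Phi _); apply/funext => m; apply/funext => n; rewrite /mul_coef.
  case: n => [|n]; first by rewrite mul0n !mul0r.
  rewrite -[LHS]mulrA -[RHS]mulrA; congr (_ * _).
  rewrite mulr1 -appell_ser_predE ?addnS //= natrD; congr (_ * _); ring.
- rewrite -[LHS]/((mul_by (fun _ s2 => k2%:R * (-1) ^+ k2 * pochhammer (- s2) k2)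
    \o pointwise Y \o iter k2 (in_t2 (@rho _ _))) (in_t1 (@Theta _ _) (B2 F)) t1 t2
   - (mul_by (fun s1 _ => k1%:R * (-1) ^+ k1 * pochhammer (- s1) k1)
    \o pointwise X \o iter k1 (in_t1 (@rho _ _))) (in_t2 (@Theta _ _) (B1 F)) t1 t2).
  rewrite (acts_by_S2 (fun m _ => (m * k1)%:R) _ _ _ Dt); last first.
    have := acts_by_Theta1 _ _ (acts_by_B2 _ _ hF).
    by apply: acts_by_eq => m n; ring.
  rewrite (acts_by_S1 (fun _ n => (n * k2)%:R) _ _ _ Dt); last first.
    have := acts_by_Theta2 _ _ (acts_by_B1 _ _ hF).
    by apply: acts_by_eq => m n; ring.
  (* Both terms have weight [m k1 n k2] on [appell_ser_pred], so [r] need not be advanced. *)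
  apply/eqP; rewrite subr_eq0; apply/eqP; congr (Phi _).
  by apply/funext => m; apply/funext => n; rewrite /mul_coef [X in X * _]mulrC.
Qed.
End Formal.

(** * Unconditional sums: finite support and divergence *)

Section Summation.
Context {K : numFieldType} {V : normedModType K} {I : choiceType}.
Implicit Types (f : I -> V) (s : seq I).
Import finmap.
Local Open Scope fset_scope.

Lemma partial_sum_fset f (A : {fset I}) :
  partial_sum f A = \sum_(i <- enum_fset A) f i.
Proof. by rewrite /partial_sum (big_seq_fsetE _ _ xpredT). Qed.

(** The partial sums are constant once the finite index set contains [s]. *)
Lemma sum_seq f s : uniq s -> (forall i, i \notin s -> f i = 0) ->
  sum f = \sum_(i <- s) f i.
Proof.
move=> us f0; apply: (@cvg_lim _ (@norm_hausdorff _ V) _ totally totally_filter).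
apply: (@cvg_near_cst _ _ _ _ totally totally_filter).
exists [fset i in s] => // B /= sB; rewrite partial_sum_fset.
transitivity (\sum_(i <- enum_fset [fset i in s]) f i).
  by rewrite -(big_fset_incl _ sB) // => i _; rewrite !inE /=; apply: f0.
apply: perm_big; apply: uniq_perm => //.
by move=> i; rewrite inE.
Qed.

(** A limit would put the partial sums over a large finite set [A] and over [A] plus one point [e m]
    within [d / 2] of it, while they differ by [f (e m)]. Without a limit, [sum] takes its default
    value. *)
Lemma sum_divergent f (e : nat -> I) (d : K) (M : nat) : injective e -> 0 < d ->
  (forall m, (M <= m)%N -> d <= `|f (e m)|) -> sum f = point.
Proof.
move=> e_inj d0 fd; apply: dvgP => cvf.
have [+ _] := @cvgrPdist_lt _ _ _ totally (@filter_filter _ _ totally_filter)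
  (partial_sum f) (lim (partial_sum f @ totally)%classic).
move=> /(_ cvf (d / 2) (divr_gt0 d0 (ltr0Sn _ 1))) [A _ /= hA].
(* Pigeonhole: [A] cannot contain the images under [e] of one more index than it has elements. *)
have [m Mm mA] : exists2 m, (M <= m)%N & e m \notin A.
  apply: contrapT => /forall2NP hm.
  have sub : {subset map e (iota M #|` A|.+1) <= enum_fset A}.
    move=> _ /mapP[m + ->]; rewrite mem_iota => /andP[Mm _].
    by have [//|/negP] := hm m; rewrite negbK.
  have := uniq_leq_size _ sub.
  by rewrite map_inj_uniq // iota_uniq size_map size_iota ltnn => /(_ isT).
have h1 : `|lim (partial_sum f @ totally)%classic - partial_sum f A| < d / 2.
  exact: hA (fsubset_refl A).
have h2 : `|lim (partial_sum f @ totally)%classic - partial_sum f (e m |` A)| < d / 2.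
  exact: hA (fsubsetUr _ _).
have fem : f (e m) = partial_sum f (e m |` A) - partial_sum f A.
  by rewrite !partial_sum_fset big_fsetU1 //= addrK.
suff : `|f (e m)| < d by move/(le_lt_trans (fd _ Mm)); rewrite ltxx.
rewrite fem [X in _ < X](splitr d).
rewrite -(subrKA (lim (partial_sum f @ totally)%classic)).
apply: (le_lt_trans (ler_normD _ _)); apply: ltrD => //.
by rewrite distrC.
Qed.
End Summation.

(** * Growth of the terms along an axis *)

Section Growth.
Context {R : realType}.
Local Notation C := R[i].

(** A norm in [R[i]] is again a complex number, so the archimedean bound is taken from the real
    number behind it. *)
Lemma complex_norm_bound (z : C) : exists n : nat, `|z| <= n%:R.
Proof.
rewrite normc_def; set y := Num.sqrt _.
exists (Num.Def.archi_bound y).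
rewrite -(rmorph_nat (real_complex R)) lecR.
by apply/ltW/archi_boundP/sqrtr_ge0.
Qed.

Lemma norm_add_nat_ge (u : C) (A m : nat) : `|u| <= A%:R -> (A <= m)%N ->
  (m - A)%:R <= `|u + m%:R|.
Proof.
move=> uA Am; rewrite natrB // lerBlDr.
apply: le_trans (lerD (lexx `|u + m%:R|) uA).
by have := ler_normB (u + m%:R) u; rewrite addrAC subrr add0r normr_nat.
Qed.

(** Every factor has modulus at least [m - A >= 1], so further factors cannot push the product below
    the bound for one. *)
Lemma norm_pochhammer_ge (u : C) (A m k : nat) : `|u| <= A%:R -> (A < m)%N ->
  (0 < k)%N -> (m - A)%:R <= `|pochhammer (u + m%:R) k|.
Proof.
move=> uA Am.
have fac i : (m - A)%:R <= `|u + m%:R + i%:R|.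
  rewrite -addrA -natrD; apply: le_trans (norm_add_nat_ge _ _ _ uA _).
    by rewrite ler_nat leq_sub2r ?leq_addr.
  by apply: leq_trans (ltnW Am) _; rewrite leq_addr.
have mA1 : 1 <= (m - A)%:R :> C by rewrite ler1n subn_gt0.
elim: k => [//|k IHk] _; rewrite pochhammerS normrM.
case: k IHk => [_|k IHk]; first by rewrite pochhammer0 normr1 mul1r.
apply: le_trans (IHk isT) _; rewrite ler_peMr //.
by apply: le_trans mA1 (fac _).
Qed.

Lemma leq_ratio_aux A B m : (3 * A + 4 * B + 2 <= m)%N ->
  [/\ A < m, A + m <= 2 * (m - A), m < 2 * (m - A) & 4 * B <= m - A]%N.
Proof. by move=> h; split; lia. Qed.

(** The right side over the left is the modulus of the ratio of consecutive terms along an axis.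
    With [A] bounding all parameters and [d = m - A], the right side is at least [d^3 |x|] and the
    left at most [(2 d)^2]. *)
Lemma coef_ratio_ge1 (a b c t x : C) k : (0 < k)%N -> x != 0 ->
  exists M, forall m, (M <= m)%N ->
  `|c + m%:R| * m.+1%:R <=
  `|a + m%:R| * `|b + m%:R| * `|pochhammer (- t + (m * k)%:R) k| * `|x|.
Proof.
move=> k0 x0.
have [Aa ha] := complex_norm_bound a; have [Ab hb] := complex_norm_bound b.
have [Ac hc] := complex_norm_bound c; have [At ht] := complex_norm_bound (- t).
have [B hB] := complex_norm_bound x^-1.
pose A := (Aa + Ab + Ac + At)%N.
have le_A n z : `|z| <= n%:R -> (n <= A)%N -> `|z| <= A%:R :> C.
  by move=> h nA; apply: le_trans h _; rewrite ler_nat.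
have {}ha : `|a| <= A%:R by apply: le_A ha _; rewrite /A -!addnA leq_addr.
have {}hb : `|b| <= A%:R by apply: le_A hb _; rewrite /A; lia.
have {}hc : `|c| <= A%:R by apply: le_A hc _; rewrite /A; lia.
have {}ht : `|- t| <= A%:R by apply: le_A ht _; rewrite /A; lia.
(* [3 * A <= m] gives [|c + m| <= 2 d], and [4 * B <= d] gives [d |x| >= 4], since [B] bounds
   [1 / |x|]. *)
exists (3 * A + 4 * B + 2)%N => m /leq_ratio_aux; set d := (m - A)%N.
move=> [Am cd md Bd].
have h1 := norm_add_nat_ge _ _ _ ha (ltnW Am).
have h2 := norm_add_nat_ge _ _ _ hb (ltnW Am).
have h3 : d%:R <= `|pochhammer (- t + (m * k)%:R) k|.
  have mk : (m <= m * k)%N by rewrite leq_pmulr.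
  apply: le_trans (norm_pochhammer_ge _ A _ _ ht (leq_trans Am mk) k0).
  by rewrite ler_nat leq_sub2r.
have h4 : `|c + m%:R| <= (2 * d)%:R.
  apply: le_trans (ler_normD _ _) _; rewrite normr_nat.
  by apply: le_trans (lerD hc (lexx _)) _; rewrite -natrD ler_nat.
have h5 : m.+1%:R <= (2 * d)%:R :> C by rewrite ler_nat.
have h6 : 4%:R <= d%:R * `|x|.
  apply: (@le_trans _ _ ((4 * B)%:R * `|x|)).
    rewrite natrM -mulrA ler_peMr //.
    by rewrite -(ler_pdivrMr _ _ (_ : 0 < `|x|)) ?normr_gt0 // div1r -normfV.
  by apply: ler_wpM2r => //; rewrite ler_nat.
apply: (@le_trans _ _ ((2 * d)%:R * (2 * d)%:R)); first exact: ler_pM.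
apply: (@le_trans _ _ (d%:R * d%:R * (d%:R * `|x|))).
  have -> : (2 * d)%:R * (2 * d)%:R = d%:R * d%:R * 4%:R :> C by rewrite natrM; ring.
  by apply: ler_wpM2l => //; apply: mulr_ge0.
rewrite mulrA; apply: ler_wpM2r => //.
by apply: ler_pM => //; apply: ler_pM.
Qed.

(** By [coef_ratio_ge1] the moduli do not decrease from [M] on, so the term at [M] provides the
    bound. *)
Lemma appell_row_bounded_below (a b c t x : C) k : (0 < k)%N ->
  (forall n, c + n%:R != 0) ->
  (forall m, poch_ratio a c m * appell_factor b k t m * x ^+ m != 0) ->
  exists d M, 0 < d /\ forall m, (M <= m)%N ->
    d <= `|poch_ratio a c m * appell_factor b k t m * x ^+ m|.
Proof.
move=> k0 hc u0; pose u m := poch_ratio a c m * appell_factor b k t m * x ^+ m.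
have x0 : x != 0.
  by apply: contra_neq (u0 1) => ->; rewrite expr1 mulr0.
have [M hM] := coef_ratio_ge1 a b c t x k k0 x0.
exists `|u M|, M; rewrite normr_gt0 u0; split=> // m.
rewrite -[leRHS]/(`|u m|).
elim: m => [|m IHm]; first by rewrite leqn0 => /eqP ->.
rewrite leq_eqVlt => /orP[/eqP ->//|]; rewrite ltnS => Mm.
apply: le_trans (IHm Mm) _.
have cm0 : 0 < `|c + m%:R| * m.+1%:R by rewrite mulr_gt0 ?normr_gt0.
have e : (c + m%:R) * m.+1%:R * u m.+1 = (-1) ^+ k *
    ((a + m%:R) * (b + m%:R) * pochhammer (- t + (m * k)%:R) k * x) * u m.
  rewrite /u /poch_ratio /appell_factor !pochhammerS mulSnr exprD pochhammerD exprS.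
  rewrite factS natrM; field.
  by rewrite nat1r !pnatr_eq0 -lt0n fact_gt0 hc pochhammer_neq0.
move: (u m) (u m.+1) e => v v' e; rewrite -(ler_pM2l cm0)
  -[X in _ <= _ * X * _]normr_nat -!normrM e.
rewrite !normrM normrX normrN1 expr1n mul1r.
by apply: ler_wpM2r => //; apply: hM.
Qed.
End Growth.

Lemma mulf4_eq0 (K : idomainType) (u v w z : K) :
  u * v * w * z = 0 -> [\/ u = 0, v = 0, w = 0 | z = 0].
Proof.
by move=> /eqP; rewrite !mulf_eq0 -!orbA => /or4P[]/eqP;
  [constructor 1|constructor 2|constructor 3|constructor 4].
Qed.

(** * Evaluation of a series truncated to a square of indices *)

Section TruncatedEvaluation.
Context {R : realType}.
Local Notation C := R[i].
Variables (N : nat) (x y : C).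

Definition trunc_eval (s : series2 R) : C^o :=
  \sum_(m < N) \sum_(n < N) s m n * (x ^+ m * y ^+ n).

Lemma trunc_eval_linear : linear trunc_eval.
Proof.
move=> g s s'; rewrite /trunc_eval scaler_sumr -big_split.
apply: eq_bigr => m _; rewrite /= scaler_sumr -big_split.
apply: eq_bigr => n _; rewrite -[LHS]/((g * s m n + s' m n) * _).
by rewrite mulrDl -mulrA.
Qed.

HB.instance Definition _ :=
  GRing.isLinear.Build C (series2 R) C^o _ trunc_eval trunc_eval_linear.

(** Multiplication by [x] moves row [N - 1] onto row [N], which the truncation cuts off; the
    hypothesis says that row [N] contributes nothing. *)
Lemma trunc_eval_mulx s :
  (forall n, series2_mulx s N n * (x ^+ N * y ^+ n) = 0) ->
  x * trunc_eval s = trunc_eval (series2_mulx s).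
Proof.
move=> s0; rewrite /trunc_eval.
transitivity (\sum_(m < N.+1) \sum_(n < N)
    series2_mulx s m n * (x ^+ m * y ^+ n)); last first.
  by rewrite big_ord_recr /= [X in _ + X]big1 ?addr0 // => n _; apply: s0.
rewrite big_ord_recl /= [X in _ = X + _]big1 ?add0r => [|n _]; last by rewrite mul0r.
rewrite mulr_sumr; apply: eq_bigr => m _.
by rewrite mulr_sumr; apply: eq_bigr => n _; rewrite /= exprS; ring.
Qed.

Lemma trunc_eval_muly s :
  (forall m, series2_muly s m N * (x ^+ m * y ^+ N) = 0) ->
  y * trunc_eval s = trunc_eval (series2_muly s).
Proof.
move=> s0; rewrite /trunc_eval mulr_sumr; apply: eq_bigr => m _.
transitivity (\sum_(n < N.+1) series2_muly s m n * (x ^+ m * y ^+ n)); last first.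
  by rewrite big_ord_recr /= s0 addr0.
rewrite big_ord_recl /= mul0r add0r.
by rewrite mulr_sumr; apply: eq_bigr => n _; rewrite /= exprS; ring.
Qed.
End TruncatedEvaluation.

(** * The dichotomy between finite and divergent series *)

Section Appell.
Context {R : realType}.
Local Notation C := R[i].
Variables (a b1 b2 c : C) (k1 k2 : nat).
Hypothesis hc : forall n, c + n%:R != 0.
Hypothesis k1_gt0 : (0 < k1)%N.
Hypothesis k2_gt0 : (0 < k2)%N.

Let r := poch_ratio a c.

Lemma appell1_coefE t1 t2 m n :
  appell1_coef a b1 b2 c t1 t2 k1 k2 m n
  = appell_ser a b1 b2 c k1 k2 t1 t2 m n.
Proof.
rewrite /appell1_coef /appell_ser /poch_ratio /appell_factor !invfM.
by ring.
Qed.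

Variables x y : C.

Lemma appell1E t1 t2 : appell1 a b1 b2 c t1 t2 k1 k2 x y =
  sum (fun i : nat * nat =>
    appell_ser a b1 b2 c k1 k2 t1 t2 i.1 i.2 * (x ^+ i.1 * y ^+ i.2) : C^o).
Proof.
rewrite /appell1; congr sum; apply/funext => i.
by rewrite appell1_coefE mulrA.
Qed.

Lemma appell_factor0 b k (t : C) : appell_factor b k t 0 = 1.
Proof. by rewrite /appell_factor !pochhammer0 fact0 !mul1r invr1. Qed.

(* Stated for [appell_ser_pred], whose zero set is the smaller one: equation (3)
   applies the functional to multiples of it. *)
Definition vanishes_beyond N (s1 s2 : C) := forall m n, (N <= m)%N || (N <= n)%N ->
  appell_ser_pred a b1 b2 c k1 k2 s1 s2 m n * (x ^+ m * y ^+ n) = 0.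

(** Terms outside the square vanish: a zero of [r] at the predecessor index passes up by
    [poch_ratio_eq0], and the other factors of [appell_ser_pred] are those of [appell_ser]. *)
Lemma appell1_trunc N s1 s2 : vanishes_beyond N s1 s2 ->
  appell1 a b1 b2 c s1 s2 k1 k2 x y
  = trunc_eval N x y (appell_ser a b1 b2 c k1 k2 s1 s2).
Proof.
move=> hN; rewrite appell1E.
have si j : (j \in iota 0 N) = (j < N)%N by rewrite mem_iota.
rewrite (sum_seq _ [seq (m, n) | m <- iota 0 N, n <- iota 0 N]).
- have -> : iota 0 N = index_iota 0 N by rewrite /index_iota subn0.
  rewrite big_allpairs /trunc_eval big_mkord.
  by apply: eq_bigr => m _; rewrite big_mkord.
- by apply: allpairs_uniq; rewrite ?iota_uniq // => -[? ?] [].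
move=> [m n] mn; have {}hN := hN m n; rewrite /= /appell_ser.
have : (N <= m)%N || (N <= n)%N.
  apply/orP; case: (leqP N m) => mN; [by left|right].
  rewrite leqNgt; apply: (contraNN _ mn) => nN.
  by apply/allpairsP; exists (m, n); rewrite !si.
by move=> /hN /mulf4_eq0[/(poch_ratio_eq0 a c _ _ (leq_pred _))|||] ->;
  rewrite ?(mul0r, mulr0).
Qed.

(** The closure of [D] under unit steps in the finite case; away from 0, zeros of [appell_factor]
    survive the shift. *)
Lemma vanishes_beyond1 N s1 s2 : vanishes_beyond N s1 s2 -> s1 != 0 ->
  vanishes_beyond N (s1 - 1) s2.
Proof.
move=> h s0 m n /h /mulf4_eq0; rewrite /appell_ser_pred.
move=> [->|/(appell_factor_shift_eq0 _ _ _ _ s0) ->|->|->];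
  by rewrite ?(mul0r, mulr0).
Qed.

Lemma vanishes_beyond2 N s1 s2 : vanishes_beyond N s1 s2 -> s2 != 0 ->
  vanishes_beyond N s1 (s2 - 1).
Proof.
move=> h s0 m n /h /mulf4_eq0; rewrite /appell_ser_pred.
move=> [->|->|/(appell_factor_shift_eq0 _ _ _ _ s0) ->|->];
  by rewrite ?(mul0r, mulr0).
Qed.

(** When [r] has no zeros, this makes every term along one axis nonzero; including [z ^+ m] places a
    zero variable on the finite side. *)
Definition never_vanishes b k (z t : C) :=
  forall m, appell_factor b k t m * z ^+ m != 0.

(** By [appell_factor_shift] only [t = m k] could create a zero, but then [(-t)_{(m+1)k}] already
    contains the factor [- t + m k = 0], as [k] is positive. *)
Lemma never_vanishesB b k z t : (0 < k)%N ->
  never_vanishes b k z t -> never_vanishes b k z (t - 1).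
Proof.
move=> k0 h m.
have nz n : appell_factor b k t n != 0 /\ z ^+ n != 0.
  by apply/andP; rewrite -negb_or -mulf_eq0; apply: h.
apply: mulf_neq0 (nz m).2.
have : (t - (m * k)%:R) * appell_factor b k t m != 0.
  apply: mulf_neq0 (nz m).1; rewrite -oppr_eq0 opprB addrC.
  apply: contra_neq (nz m.+1).1 => e.
  rewrite /appell_factor; have -> : pochhammer (- t) (m.+1 * k) = 0.
    rewrite mulSnr pochhammerD e -(prednK k0) -add1n pochhammerD.
    by rewrite pochhammerS addr0 !(mul0r, mulr0).
  by rewrite mulr0 mul0r.
by rewrite -appell_factor_shift; apply: contra_neq => ->; rewrite mulr0.
Qed.

(** On the axis where the other index is 0 the other factor is 1, so [appell_row_bounded_below]
    applies; the default value [point] is 0. *)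
Lemma appell1_divergent s1 s2 : (forall l, r l != 0) ->
  never_vanishes b1 k1 x s1 \/ never_vanishes b2 k2 y s2 ->
  appell1 a b1 b2 c s1 s2 k1 k2 x y = 0.
Proof.
move=> r0 [] nv; rewrite appell1E.
  have u0 m : r m * appell_factor b1 k1 s1 m * x ^+ m != 0.
    by rewrite -mulrA mulf_neq0.
  have [d [M [d0 hM]]] := appell_row_bounded_below a b1 c s1 x k1 k1_gt0 hc u0.
  apply: (sum_divergent _ (fun m => (m, 0%N)) d M) => [? ? []| |m /hM] //.
  by rewrite /appell_ser /= appell_factor0 addn0 !mulr1.
have u0 m : r m * appell_factor b2 k2 s2 m * y ^+ m != 0.
  by rewrite -mulrA mulf_neq0.
have [d [M [d0 hM]]] := appell_row_bounded_below a b2 c s2 y k2 k2_gt0 hc u0.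
apply: (sum_divergent _ (fun m => (0%N, m)) d M) => [? ? []| |m /hM] //.
by rewrite /appell_ser /= appell_factor0 mulr1 mul1r.
Qed.

(** A zero term comes from [(b)_N], [(-t)_{Nk}] or [z^N], each of which divides its successors; the
    remaining factor [sg] is never 0. *)
Lemma not_never_vanishes b k (z t : C) : ~ never_vanishes b k z t ->
  exists N, forall m, (N <= m)%N -> appell_factor b k t m * z ^+ m = 0.
Proof.
move=> /existsNP[N /negP]; rewrite negbK => /eqP zN; exists N => m Nm.
pose sg j : C := (-1) ^+ (j * k) / j`!%:R.
have factorE j : appell_factor b k t j * z ^+ j
    = pochhammer b j * pochhammer (- t) (j * k) * z ^+ j * sg j.
  by rewrite /appell_factor /sg; ring.
have sgN : sg N != 0.
  by rewrite mulf_neq0 ?signr_eq0 // invr_neq0 // pnatr_eq0 -lt0n fact_gt0.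
have : pochhammer b N * pochhammer (- t) (N * k) * z ^+ N * sg N = 0.
  by rewrite -factorE.
rewrite factorE -(subnKC Nm) mulnDl !pochhammerD exprD.
move=> /mulf4_eq0[->|->|->|/eqP]; rewrite ?(negPf sgN) //.
all: by rewrite !(mul0r, mulr0).
Qed.

Lemma vanishes_beyond_ex s1 s2 :
  (exists l, r l = 0) \/
    ~ never_vanishes b1 k1 x s1 /\ ~ never_vanishes b2 k2 y s2 ->
  exists N, vanishes_beyond N s1 s2.
Proof.
case=> [[l rl]|[/not_never_vanishes[N1 h1] /not_never_vanishes[N2 h2]]].
  (* The successor makes up for the predecessor in the index of [r]. *)
  exists l.+1 => m n lmn; have le : (l <= (m + n).-1)%N by lia.
  by rewrite /appell_ser_pred (poch_ratio_eq0 a c _ _ le rl) !mul0r.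
exists (maxn N1 N2) => m n; rewrite !geq_max => mn.
have : appell_factor b1 k1 s1 m * x ^+ m = 0 \/ appell_factor b2 k2 s2 n * y ^+ n = 0.
  by case/orP: mn => /andP[? ?]; [left; apply: h1|right; apply: h2].
have -> : appell_ser_pred a b1 b2 c k1 k2 s1 s2 m n * (x ^+ m * y ^+ n)
    = r (m + n).-1 * (appell_factor b1 k1 s1 m * x ^+ m)
      * (appell_factor b2 k2 s2 n * y ^+ n).
  by rewrite /appell_ser_pred /r; ring.
by move=> [] ->; rewrite ?mulr0 ?mul0r.
Qed.

Lemma appell1_system_values t1 t2 :
  @appell1_system C C^o a b1 b2 c k1 k2 (fun v => x * v) (fun v => y * v)
    (fun s1 s2 => appell1 a b1 b2 c s1 s2 k1 k2 x y) t1 t2.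
Proof.
have mulCZ (z g : C) (v : C^o) : g *: (z * v : C^o) = z * (g *: v) by exact: mulrCA.
(* The split is made once, at [(t1, t2)]; [D] carries its outcome to the shifted points whose values
   matter. *)
have [/vanishes_beyond_ex[N hN]|] := pselect ((exists l, r l = 0) \/
    ~ never_vanishes b1 k1 x t1 /\ ~ never_vanishes b2 k2 y t2).
  apply: (appell1_system_of_linear a b1 b2 c k1 k2 hc k1_gt0 k2_gt0 _
    (trunc_eval N x y) _ _ _ _ (vanishes_beyond N)) => //.
  - exact: vanishes_beyond1.
  - exact: vanishes_beyond2.
  - move=> s1 s2 s w h e; apply: trunc_eval_mulx => n.
    by rewrite e /mul_coef -mulrA h ?mulr0 // leqnn.
  - move=> s1 s2 s w h e; apply: trunc_eval_muly => m.
    by rewrite e /mul_coef -mulrA h ?mulr0 // leqnn orbT.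
  - by move=> s1 s2 /appell1_trunc.
(* In the divergent case [Phi] is 0; [r] does not depend on the point, so it stays nonzero on all of
   [D]. *)
move=> /not_orP[/forallNP r0 /not_andP nv].
apply: (appell1_system_of_linear a b1 b2 c k1 k2 hc k1_gt0 k2_gt0 _
  (\0 : {linear series2 R -> C^o}) _ _ _ _ (fun s1 s2 =>
   never_vanishes b1 k1 x s1 \/ never_vanishes b2 k2 y s2)) => //.
- by move=> s1 s2 [/never_vanishesB|]; [left; auto|right].
- by move=> s1 s2 [|/never_vanishesB]; [left|right; auto].
- by move=> *; rewrite mulr0.
- by move=> *; rewrite mulr0.
- by move=> s1 s2 /appell1_divergent ->// l; apply/eqP/r0.
- by case: nv => /contrapT; [left|right].
Qed.

Lemma appell1_system_series t1 t2 :
  @appell1_system C (series2 R) a b1 b2 c k1 k2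
    (@series2_mulx R) (@series2_muly R)
    (fun s1 s2 => appell1_series a b1 b2 c s1 s2 k1 k2) t1 t2.
Proof.
apply: (appell1_system_of_linear a b1 b2 c k1 k2 hc k1_gt0 k2_gt0 _
  (idfun : {linear series2 R -> series2 R}) _ _ _ _ (fun _ _ => True)) => //.
- move=> g v; apply/funext => -[|m]; apply/funext => n //.
  exact: (mulr0 g).
- move=> g v; apply/funext => m; apply/funext => -[|n] //.
  exact: (mulr0 g).
- move=> s1 s2 _; apply/funext => m; apply/funext => n.
  exact: appell1_coefE.
Qed.
End Appell.

Theorem mainTheorem4 (R : realType) (a b1 b2 c t1 t2 : R[i]) (k1 k2 : nat)
    (x y : R[i])
    (hc : forall n : nat, complex.Re c <> - n%:R)
    (hk1 : (0 < k1)%N) (hk2 : (0 < k2)%N)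
    (hx : `|x| < 1) (hy : `|y| < 1) :
  @appell1_system R[i] R[i]^o a b1 b2 c k1 k2
    (fun v => x * v) (fun v => y * v)
    (fun s1 s2 => appell1 a b1 b2 c s1 s2 k1 k2 x y) t1 t2
  /\
  @appell1_system R[i] (series2 R) a b1 b2 c k1 k2
    (@series2_mulx R) (@series2_muly R)
    (fun s1 s2 => appell1_series a b1 b2 c s1 s2 k1 k2) t1 t2.
Proof.
have c_neq0 n : c + n%:R != 0.
  apply/eqP => /eqP; rewrite addr_eq0 => /eqP cE; apply: (hc n).
  by rewrite cE -(rmorph_nat (real_complex R)) -rmorphN.
by split; [apply: appell1_system_values|apply: appell1_system_series].
Qed.
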